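(* Let $\mathcal{R}$ be any relation on processes with $\simeq\;\subseteq\mathcal{R}\subseteq\;\approx$ (branching bisimilarity contained in $\mathcal{R}$, contained in weak bisimilarity). Then the following problem is undecidable: given a normed one counter net and two of its processes $P,Q$, decide whether $P\,\mathcal{R}\,Q$.
   Context: A one counter net is a tuple $(\mathcal{Q},X,\mathcal{A},\Delta)$ where $\mathcal{Q}$ is a finite set of states, $X$ is a place, $\mathcal{A}$ is a finite set of actions containing a special silent action $\tau$, and $\Delta$ is a finite set of rules of the form $pX^{i}\stackrel{\ell}{\longrightarrow}qX^{j}$ with $i\in\{0,1\}$, $j\ge 0$, $\ell\in\mathcal{A}$. Processes are $pX^{n}$ ($p$ a state, $n\ge 0$ the number of tokens). Semantics: $pX^{i+k}\stackrel{\ell}{\longrightarrow}qX^{j+k}$ for all $k\ge0$ whenever $pX^{i}\stackrel{\ell}{\longrightarrow}qX^{j}\in\Delta$. A process $P$ is normed if there are actions $\ell_1,\dots,\ell_m$ and a state $p$ with $P\stackrel{\ell_1}{\longrightarrow}\cdots\stackrel{\ell_m}{\longrightarrow}p$ (i.e. $pX^0$) and $p$ has no outgoing transition; the net is normed if all its processes are normed. Write $\Longrightarrow$ for the reflexive transitive closure of $\stackrel{\tau}{\longrightarrow}$, and $\stackrel{\widehat{\ell}}{\Longrightarrow}$ for $\Longrightarrow\stackrel{\ell}{\longrightarrow}\Longrightarrow$ if $\ell\neq\tau$ and for $\Longrightarrow$ if $\ell=\tau$. A relation $\mathcal{B}$ is a weak bisimulation if whenever $P\mathcal{B}Q$ and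 $P\stackrel{\ell}{\longrightarrow}P'$ there is $Q'$ with $Q\stackrel{\widehat{\ell}}{\Longrightarrow}Q'$ and $P'\mathcal{B}Q'$, and symmetrically for moves of $Q$; $\approx$ is the largest weak bisimulation. A relation $\mathcal{B}$ is a branching bisimulation if whenever $P\mathcal{B}Q$ and $P\stackrel{\ell}{\longrightarrow}P'$, either (i) $Q\Longrightarrow Q''\stackrel{\ell}{\longrightarrow}Q'$ with $P\mathcal{B}Q''$ and $P'\mathcal{B}Q'$, or (ii) $\ell=\tau$ and $P'\mathcal{B}Q$; and symmetrically for moves of $Q$. $\simeq$ is the largest branching bisimulation. *)

(* Defs.v *)
From Stdlib Require Import List Arith.
Import ListNotations.

Definition action := nat.
Definition tau : action := 0.

(* A rule  p X^i --l--> q X^j  with i in {0,1} (i = true means i = 1). *)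
Record rule := Rule { r_src : nat; r_i : bool; r_lab : action; r_tgt : nat; r_j : nat }.

Record ocn := OCN { n_states : nat; n_rules : list rule }.

Definition ocn_wf (N : ocn) : Prop :=
  forall r, In r (n_rules N) -> r_src r < n_states N /\ r_tgt r < n_states N.

(* A process p X^n is a pair (p, n). *)
Definition proc := (nat * nat)%type.

Definition is_proc (N : ocn) (P : proc) : Prop := fst P < n_states N.

Definition step (N : ocn) (P : proc) (l : action) (P' : proc) : Prop :=
  exists r k, In r (n_rules N) /\
    P = (r_src r, (if r_i r then 1 else 0) + k) /\
    l = r_lab r /\ P' = (r_tgt r, r_j r + k).

Inductive reach (N : ocn) : proc -> proc -> Prop :=
| reach_refl P : reach N P P
| reach_step P l P' P'' : step N P l P' -> reach N P' P'' -> reach N P P''.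

Definition normed_proc (N : ocn) (P : proc) : Prop :=
  exists p, reach N P (p, 0) /\ (forall l P', ~ step N (p, 0) l P').

Definition normed (N : ocn) : Prop :=
  forall P, is_proc N P -> normed_proc N P.

Inductive tau_star (N : ocn) : proc -> proc -> Prop :=
| ts_refl P : tau_star N P P
| ts_step P P' P'' : step N P tau P' -> tau_star N P' P'' -> tau_star N P P''.

Definition weak_step (N : ocn) (P : proc) (l : action) (P' : proc) : Prop :=
  if Nat.eqb l tau then tau_star N P P'
  else exists P1 P2, tau_star N P P1 /\ step N P1 l P2 /\ tau_star N P2 P'.

Definition is_weak_bisim (N : ocn) (B : proc -> proc -> Prop) : Prop :=
  forall P Q, B P Q ->
    (forall l P', step N P l P' -> exists Q', weak_step N Q l Q' /\ B P' Q') /\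
    (forall l Q', step N Q l Q' -> exists P', weak_step N P l P' /\ B P' Q').

Definition weakly_bisimilar (N : ocn) (P Q : proc) : Prop :=
  exists B, is_weak_bisim N B /\ B P Q.

Definition is_branching_bisim (N : ocn) (B : proc -> proc -> Prop) : Prop :=
  forall P Q, B P Q ->
    (forall l P', step N P l P' ->
       (exists Q'' Q', tau_star N Q Q'' /\ step N Q'' l Q' /\ B P Q'' /\ B P' Q')
       \/ (l = tau /\ B P' Q)) /\
    (forall l Q', step N Q l Q' ->
       (exists P'' P', tau_star N P P'' /\ step N P'' l P' /\ B P'' Q /\ B P' Q')
       \/ (l = tau /\ B P Q')).

Definition branching_bisimilar (N : ocn) (P Q : proc) : Prop :=
  exists B, is_branching_bisim N B /\ B P Q.

(* INC r: increment register r, go to next instruction.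
   DEC r k: if register r is 0 jump to k, else decrement it and go to next.
   The machine halts when the program counter leaves the program. *)
Inductive instr := INC (r : nat) | DEC (r : nat) (k : nat).
Definition cm := list instr.

Definition regs := nat -> nat.
Definition upd (f : regs) (r v : nat) : regs :=
  fun x => if Nat.eqb x r then v else f x.

Definition cm_step (M : cm) (pc : nat) (g : regs) : nat * regs :=
  match nth_error M pc with
  | Some (INC r) => (S pc, upd g r (S (g r)))
  | Some (DEC r k) =>
      match g r with
      | 0 => (k, g)
      | S v => (S pc, upd g r v)
      end
  | None => (pc, g)
  end.

Fixpoint cm_exec (M : cm) (fuel : nat) (pc : nat) (g : regs) : option regs :=
  if Nat.leb (length M) pc then Some g
  else match fuel with
       | 0 => None
       | S f => let (pc', g') := cm_step M pc g in cm_exec M f pc' g'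
       end.

Definition cm_computes (M : cm) (x y : nat) : Prop :=
  exists fuel g, cm_exec M fuel 0 (upd (fun _ => 0) 0 x) = Some g /\ g 1 = y.

Definition npair (x y : nat) : nat := (x + y) * S (x + y) / 2 + y.

Definition code_rule (r : rule) : nat :=
  npair (r_src r) (npair (if r_i r then 1 else 0)
    (npair (r_lab r) (npair (r_tgt r) (r_j r)))).

Fixpoint code_list (l : list rule) : nat :=
  match l with
  | [] => 0
  | r :: l' => S (npair (code_rule r) (code_list l'))
  end.

Definition code_ocn (N : ocn) : nat := npair (n_states N) (code_list (n_rules N)).

Definition code_proc (P : proc) : nat := npair (fst P) (snd P).

Definition code_instance (N : ocn) (P Q : proc) : nat :=
  npair (code_ocn N) (npair (code_proc P) (code_proc Q)).

Definition decides (M : cm) (Rel : ocn -> proc -> proc -> Prop) : Prop :=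
  forall N P Q, ocn_wf N -> normed N -> is_proc N P -> is_proc N Q ->
    (Rel N P Q -> cm_computes M (code_instance N P Q) 1) /\
    (~ Rel N P Q -> cm_computes M (code_instance N P Q) 0).

(* Main.v *)
(** Given a counter machine [D], one builds a normed net in which the process
    "[D] at instruction [p] with registers coded by [n]" is equivalent to the process
    [Guess] exactly when [D] runs forever from there; registers are coded by the
    exponents in a prime factorisation, so that one step of [D] amounts to finitely
    many affine steps [n -> m] with [u * n + v = a * m + b].  [Guess] can silently
    change its counter at will, so all processes [Guess X^k] are equivalent.  When the
    attacker makes a state ask for its successor, the defender, who plays from
    [Guess], silently sets the counter to the value [m] it claims.  The attacker then
    either checks the claim, by comparing processes that count [u * n + v] and
    [a * m + b] visible actions, or accepts it; in the latter case the asking side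
    becomes [Guess] and the answering side becomes the next configuration, so the
    old value [n] is forgotten and the same situation recurs with the sides swapped.
    Bisimilarity then means existence of an infinite run, for branching as well as
    for weak bisimilarity.  Normedness is free: every state can visibly enter a
    state that silently discards all tokens.

    Undecidability is by diagonalisation: from a decider [M] one programs a machine
    [D] which, on input [c], runs [M] on the instance made of the net coded by [c]
    and the two processes that represent "[D] on input [c]", and which halts iff [M]
    answers yes.  Running [D] on the code of its own net is contradictory. *)

Require Import Defs.
From Stdlib Require Import List Arith Lia FunctionalExtensionality Cantor.
From mathcomp Require ssreflect ssrfun ssrbool eqtype ssrnat div prime.
Import ListNotations.

(** * Register contents coded by exponents of primes *)

Module Goedel.
Import ssreflect ssrfun ssrbool eqtype ssrnat div prime.

(** Each prime is merely some prime above the previous one; distinctness is what matters. Starting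
    at 2 makes [2 ^ c] the code of input [c] in register 0. *)
Fixpoint base (r : nat) : nat :=
  if r is r'.+1 then s2val (prime_above (base r')) else 2.

Definition expo (r n : nat) : nat := logn (base r) n.

Lemma base_prime r : prime (base r).
Proof. by case: r => [//|r] /=; case: (prime_above _). Qed.

Lemma base_ge2 r : le 2 (base r).
Proof. by apply/leP; exact: prime_gt1 (base_prime r). Qed.

Lemma base_mono r s : r < s -> base r < base s.
Proof.
elim: s => // s IHs; rewrite ltnS leq_eqVlt.
have lt_s : base s < base s.+1 by rewrite /=; case: (prime_above _).
by case/orP => [/eqP -> //|/IHs]; move/ltn_trans; apply.
Qed.

Lemma base_inj r s : base r = base s -> r = s.
Proof. by case: (ltngtP r s) => // /base_mono + E; rewrite E ltnn. Qed.

Lemma expo_base_mul r n : lt 0 n -> expo r (Nat.mul (base r) n) = S (expo r n).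
Proof.
move/ltP => n0; rewrite /expo -[Nat.mul _ _]/(base r * n)%N.
by rewrite lognM // ?prime_gt0 ?base_prime // logn_prime ?base_prime // eqxx.
Qed.

Lemma expo_base_mul_other r s n :
  r <> s -> lt 0 n -> expo r (Nat.mul (base s) n) = expo r n.
Proof.
move=> rs /ltP n0; rewrite /expo -[Nat.mul _ _]/(base s * n)%N.
rewrite lognM // ?prime_gt0 ?base_prime // logn_prime ?base_prime //.
by case: eqP => // /base_inj.
Qed.

Lemma expo_gt0 r n : lt 0 (expo r n) -> exists m, n = Nat.mul (base r) m.
Proof.
move/ltP; rewrite logn_gt0 mem_primes => /and3P[_ _ /dvdnP[m ->]].
by exists m; rewrite mulnC.
Qed.

Lemma expo1 r : expo r 1 = 0.
Proof. exact: logn1. Qed.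

End Goedel.
Import Goedel.

Set Bullet Behavior "Strict Subproofs".

(** * Programming counter machines *)

(** Unlike [cm_exec], a run may stop anywhere, so runs of program fragments compose. *)
Inductive run (M : cm) : nat -> regs -> nat -> regs -> Prop :=
| run_refl pc g : run M pc g pc g
| run_step pc g pc1 g1 pc2 g2 :
    pc < length M -> cm_step M pc g = (pc1, g1) ->
    run M pc1 g1 pc2 g2 -> run M pc g pc2 g2.

Lemma run_trans M pc1 g1 pc2 g2 pc3 g3 :
  run M pc1 g1 pc2 g2 -> run M pc2 g2 pc3 g3 -> run M pc1 g1 pc3 g3.
Proof. induction 1; eauto using run. Qed.

Lemma run_exec_some M pc g pc' g' f h :
  run M pc g pc' g' -> cm_exec M f pc' g' = Some h ->
  exists f', cm_exec M f' pc g = Some h.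
Proof.
  induction 1 as [|pc g pc1 g1 pc2 g2 Hlt Hs _ IH]; intros H; [eauto|].
  destruct (IH H) as [f' Hf']. exists (S f'). simpl.
  rewrite (proj2 (Nat.leb_gt _ _) Hlt), Hs. exact Hf'.
Qed.

Lemma run_exec_none M pc g pc' g' :
  run M pc g pc' g' -> (forall f, cm_exec M f pc' g' = None) ->
  forall f, cm_exec M f pc g = None.
Proof.
  induction 1 as [|pc g pc1 g1 pc2 g2 Hlt Hs _ IH]; intros H f; [auto|].
  destruct f; simpl; rewrite (proj2 (Nat.leb_gt _ _) Hlt); [reflexivity|].
  rewrite Hs. auto.
Qed.

Lemma run_instr M pc g i pc' g' :
  nth_error M pc = Some i -> cm_step M pc g = (pc', g') -> run M pc g pc' g'.
Proof.
  intros Hi Hs. eapply run_step; [|exact Hs|apply run_refl].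
  apply nth_error_Some. congruence.
Qed.

(** * Loop programs and their compilation *)

Inductive cmd := Inc (r : nat) | Seq (c d : cmd) | Loop (r : nat) (c : cmd).

Fixpoint size (c : cmd) : nat :=
  match c with
  | Inc _ => 1
  | Seq c d => size c + size d
  | Loop _ c => size c + 2
  end.

(* [Loop r c] is "while r <> 0 do (decrement r; c)".  Register 5 is kept at 0,
   so that decrementing it is an unconditional jump. *)
Fixpoint compile (b : nat) (c : cmd) : cm :=
  match c with
  | Inc r => [INC r]
  | Seq c d => compile b c ++ compile (b + size c) d
  | Loop r c => DEC r (b + size c + 2) :: compile (S b) c ++ [DEC 5 b]
  end.

(** The premise [g1 5 = 0] ensures that the instruction closing a loop body does jump back. *)
Inductive ev : cmd -> regs -> regs -> Prop :=
| ev_inc r g : ev (Inc r) g (upd g r (S (g r)))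
| ev_seq c d g g1 g2 : ev c g g1 -> ev d g1 g2 -> ev (Seq c d) g g2
| ev_loop_stop r c g : g r = 0 -> ev (Loop r c) g g
| ev_loop_next r c g v g1 g2 :
    g r = S v -> ev c (upd g r v) g1 -> g1 5 = 0 -> ev (Loop r c) g1 g2 ->
    ev (Loop r c) g g2.

Lemma length_compile c b : length (compile b c) = size c.
Proof.
  revert b; induction c; intros b; simpl; auto.
  - rewrite length_app; auto.
  - rewrite length_app, IHc; simpl; lia.
Qed.

Definition code_at (D : cm) (b : nat) (C : cm) : Prop :=
  forall k i, nth_error C k = Some i -> nth_error D (b + k) = Some i.

Lemma code_at_app D b C1 C2 :
  code_at D b (C1 ++ C2) -> code_at D b C1 /\ code_at D (b + length C1) C2.
Proof.
  intros H; split; intros k i Hk.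
  - apply H. rewrite nth_error_app1; auto. apply nth_error_Some; congruence.
  - rewrite <- Nat.add_assoc. apply H. rewrite nth_error_app2 by lia.
    now replace (length C1 + k - length C1) with k by lia.
Qed.

Lemma compile_correct D c g g' :
  ev c g g' -> forall b, code_at D b (compile b c) -> run D b g (b + size c) g'.
Proof.
  induction 1 as [r g|c d g g1 g2 _ IH1 _ IH2|r c g Hr|r c g v g1 g2 Hr _ IH1 Hz _ IH2];
    intros b Hb; simpl in *.
  - assert (Hi := Hb 0 _ eq_refl). rewrite Nat.add_0_r in Hi.
    eapply run_instr; [exact Hi|]. unfold cm_step. rewrite Hi. f_equal. lia.
  - apply code_at_app in Hb as [Hb1 Hb2]. rewrite length_compile in Hb2.
    rewrite Nat.add_assoc. eapply run_trans; eauto.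
  - assert (Hi := Hb 0 _ eq_refl). rewrite Nat.add_0_r in Hi.
    eapply run_instr; [exact Hi|]. unfold cm_step. rewrite Hi, Hr. f_equal. lia.
  - assert (Hi := Hb 0 _ eq_refl). rewrite Nat.add_0_r in Hi.
    eapply run_trans with (pc2 := S b).
    { eapply run_instr; [exact Hi|]. unfold cm_step. rewrite Hi, Hr. reflexivity. }
    assert (Hb' : code_at D (S b) (compile (S b) c ++ [DEC 5 b])).
    { intros k i Hk. replace (S b + k) with (b + S k) by lia. now apply Hb. }
    apply code_at_app in Hb' as [Hb1 Hb2]. rewrite length_compile in Hb2.
    eapply run_trans; [apply IH1, Hb1|].
    eapply run_trans; [|apply IH2, Hb].
    assert (Hj := Hb2 0 _ eq_refl). rewrite Nat.add_0_r in Hj.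
    eapply run_instr; [exact Hj|]. unfold cm_step. now rewrite Hj, Hz.
Qed.

Definition move (r s : nat) : cmd := Loop r (Inc s).
Definition move2 (r s t : nat) : cmd := Loop r (Seq (Inc s) (Inc t)).

Ltac upd_simpl :=
  unfold upd; repeat (match goal with |- context [Nat.eqb ?a ?b] =>
    destruct (Nat.eqb_spec a b); try (subst; congruence) end); try lia; auto.

Lemma ev_move r s g :
  r <> s -> r <> 5 -> s <> 5 -> g 5 = 0 ->
  ev (move r s) g (upd (upd g s (g s + g r)) r 0).
Proof.
  intros Hrs Hr Hs. remember (g r) as v eqn:Hv. revert g Hv.
  induction v as [|v IH]; intros g Hv Hz.
  - replace (upd (upd g s (g s + 0)) r 0) with g; [now apply ev_loop_stop|].
    apply functional_extensionality. intros x. upd_simpl; subst; lia.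
  - eapply ev_loop_next; [symmetry; exact Hv|apply ev_inc|upd_simpl|].
    eapply eq_rect; [apply IH; upd_simpl|].
    apply functional_extensionality. intros x. upd_simpl; subst; lia.
Qed.

Lemma ev_move2 r s t g :
  r <> s -> r <> t -> s <> t -> r <> 5 -> s <> 5 -> t <> 5 -> g 5 = 0 ->
  ev (move2 r s t) g (upd (upd (upd g s (g s + g r)) t (g t + g r)) r 0).
Proof.
  intros Hrs Hrt Hst Hr Hs Ht. remember (g r) as v eqn:Hv. revert g Hv.
  induction v as [|v IH]; intros g Hv Hz.
  - replace (upd (upd (upd g s (g s + 0)) t (g t + 0)) r 0) with g; [now apply ev_loop_stop|].
    apply functional_extensionality. intros x. upd_simpl; subst; lia.
  - eapply ev_loop_next; [symmetry; exact Hv|eapply ev_seq; apply ev_inc|upd_simpl|].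
    eapply eq_rect; [apply IH; upd_simpl|].
    apply functional_extensionality. intros x. upd_simpl; subst; lia.
Qed.

(** Registers from 5 on take the default 0 of [nth], as unconditional jumps require of register
    5. *)
Definition st (a b c d e : nat) : regs := fun x => nth x [a; b; c; d; e] 0.

Ltac st_eq :=
  apply functional_extensionality;
  let x := fresh "x" in intros x; unfold upd, st;
  do 6 (destruct x as [|x]; [simpl; try lia|]); simpl; try (now destruct x).
Ltac ev_basic lem := eapply eq_rect; [apply lem; first [discriminate|reflexivity]|st_eq].

(** * Programs for pairing and for writing down the instance *)

Fixpoint tri (n : nat) : nat := match n with 0 => 0 | S m => S m + tri m end.

(** Triangular numbers can be accumulated in a loop, which avoids the division. *)
Lemma npair_tri x y : npair x y = tri (x + y) + y.
Proof.
  unfold npair. f_equal. set (n := x + y). clearbody n.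
  symmetry. apply Nat.div_unique_exact; [discriminate|].
  induction n as [|n IH]; [reflexivity|]. cbn [tri]. lia.
Qed.

(** Registers 1 and 2 hold the arguments and register 1 receives the result; register 3 saves the
    second argument, register 4 restores the loop counter. *)
Definition pair12 : cmd :=
  Seq (move2 2 1 3)
 (Seq (Loop 1 (Seq (Inc 2) (Seq (move2 1 2 4) (move 4 1))))
 (Seq (move 3 1) (move 2 1))).

Lemma ev_tri a b c d :
  ev (Loop 1 (Seq (Inc 2) (Seq (move2 1 2 4) (move 4 1))))
     (st a b c d 0) (st a 0 (c + tri b) d 0).
Proof.
  revert c. induction b as [|b IH]; intros c.
  - eapply eq_rect; [now apply ev_loop_stop|]. st_eq.
  - apply ev_loop_next with (v := b) (g1 := st a b (c + S b) d 0);
      [reflexivity| |reflexivity|].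
    + apply ev_seq with (st a b (S c) d 0); [ev_basic ev_inc|].
      apply ev_seq with (st a 0 (c + S b) d b); [ev_basic ev_move2|ev_basic ev_move].
    + replace (c + tri (S b)) with (c + S b + tri b) by (simpl; lia). apply IH.
Qed.

Lemma ev_pair12 a x y : ev pair12 (st a x y 0 0) (st a (npair x y) 0 0 0).
Proof.
  rewrite npair_tri.
  apply ev_seq with (st a (x + y) 0 y 0); [ev_basic ev_move2|].
  apply ev_seq with (st a 0 (tri (x + y)) y 0); [apply (ev_tri a (x + y) 0 y)|].
  apply ev_seq with (st a y (tri (x + y)) 0 0); [ev_basic ev_move|ev_basic ev_move].
Qed.

Lemma ev_pow2 a c b :
  ev (Loop 4 (Seq (move2 2 1 3) (Seq (move 1 2) (move 3 2)))) (st a 0 b 0 c)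
     (st a 0 (2 ^ c * b) 0 0).
Proof.
  revert b. induction c as [|c IH]; intros b.
  - eapply eq_rect; [now apply ev_loop_stop|]. st_eq.
  - apply ev_loop_next with (v := c) (g1 := st a 0 (2 * b) 0 c);
      [reflexivity| |reflexivity|].
    + apply ev_seq with (st a b 0 b c); [ev_basic ev_move2|].
      apply ev_seq with (st a 0 b b c); [ev_basic ev_move|ev_basic ev_move].
    + replace (2 ^ S c * b) with (2 ^ c * (2 * b)) by (simpl; lia). apply IH.
Qed.

Fixpoint add_const (r n : nat) (c : cmd) : cmd :=
  match n with 0 => c | S n => Seq (Inc r) (add_const r n c) end.

Lemma ev_add_const r n c g g' :
  ev c (upd g r (n + g r)) g' -> ev (add_const r n c) g g'.
Proof.
  revert g. induction n as [|n IH]; intros g H; simpl in *.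
  - replace (upd g r (g r)) with g in H; [exact H|].
    apply functional_extensionality. intros x. upd_simpl.
  - eapply ev_seq; [apply ev_inc|]. apply IH.
    eapply eq_rect with (P := fun h => ev c h g'); [exact H|].
    apply functional_extensionality. intros x. upd_simpl.
Qed.

(** The input [c] serves twice: as the code of the net and, through [2 ^ c], as the code of the
    initial registers holding [c]. The state [p] and the process code [k] are constants of the
    program. At the end only register 0 is nonzero, as the decider expects. *)
Definition encode (p k : nat) : cmd :=
  Seq (move2 0 3 4) (Seq (move 3 0) (Seq (Inc 2)
 (Seq (Loop 4 (Seq (move2 2 1 3) (Seq (move 1 2) (move 3 2))))
 (add_const 1 p (Seq pair12
 (add_const 2 k (Seq pair12
 (Seq (move 1 2) (Seq (move 0 1) (Seq pair12 (move 1 0))))))))))).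

Lemma ev_encode p k c :
  ev (encode p k) (upd (fun _ => 0) 0 c)
     (upd (fun _ => 0) 0 (npair c (npair (npair p (2 ^ c)) k))).
Proof.
  set (v := npair _ _).
  assert (E : forall n, upd (fun _ => 0) 0 n = st n 0 0 0 0) by (intros n; st_eq).
  rewrite !E.
  apply ev_seq with (st 0 0 0 c c); [ev_basic ev_move2|].
  apply ev_seq with (st c 0 0 0 c); [ev_basic ev_move|].
  apply ev_seq with (st c 0 1 0 c); [ev_basic ev_inc|].
  apply ev_seq with (st c 0 (2 ^ c * 1) 0 0); [apply ev_pow2|].
  rewrite Nat.mul_1_r.
  apply ev_add_const. replace (upd _ _ _) with (st c p (2 ^ c) 0 0) by st_eq.
  eapply ev_seq; [apply ev_pair12|].
  apply ev_add_const.
  replace (upd _ _ _) with (st c (npair p (2 ^ c)) k 0 0) by st_eq.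
  eapply ev_seq; [apply ev_pair12|]. set (w := npair (npair _ _) _) in *.
  apply ev_seq with (st c 0 w 0 0); [ev_basic ev_move|].
  apply ev_seq with (st 0 c w 0 0); [ev_basic ev_move|].
  eapply ev_seq; [apply ev_pair12|]. fold v. ev_basic ev_move.
Qed.

(** * The diagonal machine *)

Definition shift (b len : nat) (i : instr) : instr :=
  match i with INC r => INC r | DEC r k => DEC r (b + Nat.min k len) end.

(** [M] halts at any address past its end. Clamping by [Nat.min] sends all of them to the single
    address just after the embedded copy, where control continues. *)
Lemma shift_correct D b M f pc g g' :
  code_at D b (map (shift b (length M)) M) -> cm_exec M f pc g = Some g' ->
  run D (b + Nat.min pc (length M)) g (b + length M) g'.
Proof.
  intros HD. revert pc g. induction f as [|f IH]; intros pc g H; simpl in H;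
    destruct (Nat.leb_spec (length M) pc) as [Hle|Hlt]; try discriminate;
    try (injection H as <-; rewrite Nat.min_r by assumption; apply run_refl).
  unfold cm_step in H. destruct (nth_error M pc) as [i|] eqn:Hi;
    [|apply nth_error_None in Hi; lia].
  assert (HDi : nth_error D (b + pc) = Some (shift b (length M) i))
    by (apply HD; rewrite nth_error_map, Hi; reflexivity).
  assert (Hnext : b + Nat.min (S pc) (length M) = S (b + pc)) by lia.
  rewrite (Nat.min_l pc) by lia.
  destruct i as [r|r k]; simpl in HDi; [|destruct (g r) as [|v] eqn:Hg];
    (eapply run_trans; [eapply run_instr; [exact HDi|]|apply IH; exact H]);
    unfold cm_step; rewrite HDi, ?Hg, ?Hnext; reflexivity.
Qed.

(* On answer 0 the last instruction jumps to itself forever. *)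
Definition diagonal (M : cm) (p k : nat) : cm :=
  let b := size (encode p k) in
  compile 0 (encode p k) ++ map (shift b (length M)) M ++ [DEC 1 (b + length M)].

Lemma diagonal_run M p k c y :
  cm_computes M (npair c (npair (npair p (2 ^ c)) k)) y ->
  exists g, g 1 = y /\ run (diagonal M p k) 0 (upd (fun _ => 0) 0 c)
                           (size (encode p k) + length M) g.
Proof.
  intros (f & g & Hf & Hy). exists g. split; [exact Hy|].
  assert (H : code_at (diagonal M p k) 0 (diagonal M p k)) by (intros i x Hx; exact Hx).
  apply code_at_app in H as [H1 H2]. rewrite length_compile in H2.
  apply code_at_app in H2 as [H2 _].
  eapply run_trans; [exact (compile_correct _ _ _ _ (ev_encode p k c) 0 H1)|].
  rewrite !Nat.add_0_l in *.
  assert (R := shift_correct _ _ _ _ _ _ _ H2 Hf).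
  now rewrite Nat.min_0_l, Nat.add_0_r in R.
Qed.

Lemma diagonal_last M p k :
  nth_error (diagonal M p k) (size (encode p k) + length M) =
    Some (DEC 1 (size (encode p k) + length M)) /\
  length (diagonal M p k) = S (size (encode p k) + length M).
Proof.
  unfold diagonal. split.
  - rewrite nth_error_app2 by (rewrite length_compile; lia).
    rewrite nth_error_app2 by (rewrite length_compile, length_map; lia).
    rewrite length_compile, length_map.
    now replace (_ - _ - _) with 0 by lia.
  - rewrite !length_app, length_compile, length_map. simpl. lia.
Qed.

Lemma diagonal_halts M p k c :
  cm_computes M (npair c (npair (npair p (2 ^ c)) k)) 1 ->
  exists f g, cm_exec (diagonal M p k) f 0 (upd (fun _ => 0) 0 c) = Some g.
Proof.
  intros H. apply diagonal_run in H as (g & Hg & Hrun).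
  destruct (diagonal_last M p k) as [Hl Hlen].
  assert (Hrun' : run (diagonal M p k) 0 (upd (fun _ => 0) 0 c)
                      (length (diagonal M p k)) (upd g 1 0)).
  { eapply run_trans; [exact Hrun|]. eapply run_instr; [exact Hl|].
    unfold cm_step. now rewrite Hl, Hg, Hlen. }
  destruct (run_exec_some _ _ _ _ _ 0 (upd g 1 0) Hrun') as [f Hf]; [|eauto].
  simpl. now rewrite Nat.leb_refl.
Qed.

Lemma diagonal_diverges M p k c :
  cm_computes M (npair c (npair (npair p (2 ^ c)) k)) 0 ->
  forall f, cm_exec (diagonal M p k) f 0 (upd (fun _ => 0) 0 c) = None.
Proof.
  intros H. apply diagonal_run in H as (g & Hg & Hrun).
  destruct (diagonal_last M p k) as [Hl Hlen].
  apply (run_exec_none _ _ _ _ _ Hrun).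
  assert (Hlt : (length (diagonal M p k) <=? size (encode p k) + length M) = false)
    by (apply Nat.leb_gt; lia).
  induction f as [|f IH]; cbn [cm_exec]; rewrite Hlt; [reflexivity|].
  unfold cm_step. rewrite Hl, Hg. exact IH.
Qed.

(** * The net of a counter machine *)

Local Opaque base to_nat.

(* [Mul k a j] multiplies the counter by [a], adds [j] and jumps to [k]. *)
Inductive mst := Pg (p : nat) | Mul (k a j : nat).

Definition slope (s : mst) : nat := match s with Pg _ => 1 | Mul _ a _ => a end.
Definition offset (s : mst) : nat := match s with Pg _ => 0 | Mul _ _ j => j end.
Definition target (s : mst) : nat := match s with Pg p => p | Mul k _ _ => k end.
Definition value (s : mst) (n : nat) : nat := slope s * n + offset s.

Lemma value_Pg p n : value (Pg p) n = n.
Proof. unfold value; simpl; lia. Qed.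

Definition regs_of (n : nat) : regs := fun r => expo r n.

Lemma regs_of_mul r n :
  0 < n -> regs_of (base r * n) = upd (regs_of n) r (S (regs_of n r)).
Proof.
  intros Hn. apply functional_extensionality. intros x. unfold upd, regs_of.
  destruct (Nat.eqb_spec x r) as [->|Hx].
  - now apply expo_base_mul.
  - now apply expo_base_mul_other.
Qed.

Lemma regs_of_div r n v :
  0 < n -> regs_of (base r * n) r = S v ->
  upd (regs_of (base r * n)) r v = regs_of n.
Proof.
  intros Hn Hv. rewrite regs_of_mul in * by assumption.
  apply functional_extensionality. intros x. unfold upd in *.
  rewrite Nat.eqb_refl in Hv. injection Hv as <-.
  now destruct (Nat.eqb_spec x r) as [->|].
Qed.

Lemma regs_of_pow2 c : regs_of (2 ^ c) = upd (fun _ => 0) 0 c.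
Proof.
  change 2 with (base 0).
  induction c as [|c IH].
  - apply functional_extensionality. intros x. unfold regs_of, upd. simpl.
    rewrite expo1. now destruct (x =? 0).
  - cbn [Nat.pow]. rewrite regs_of_mul.
    + rewrite IH. apply functional_extensionality. intros x. unfold upd.
      now destruct (x =? 0).
    + apply Nat.neq_0_lt_0, Nat.pow_nonzero. pose proof (base_ge2 0). lia.
Qed.

(* [Ans a b q] holding [m] claims that the asking side is worth [a * m + b] and moves
   to state [q] with value [m]; [Ch a i] holding [n] performs exactly [a * n + i] visible
   [count] actions. *)
Inductive nst :=
| Guess | Drain
| At (s : mst) | Ask (s : mst)
| Ans (a b : nat) (q : mst)
| Ch (a i : nat).

Definition mcode (s : mst) : nat :=
  match s with
  | Pg p => to_nat (0, p)
  | Mul k a j => to_nat (1, to_nat (k, to_nat (a, j)))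
  end.

Definition ncode (s : nst) : nat :=
  match s with
  | Guess => to_nat (0, 0)
  | Drain => to_nat (0, 1)
  | At s => to_nat (1, mcode s)
  | Ask s => to_nat (2, mcode s)
  | Ans a b q => to_nat (3, to_nat (a, to_nat (b, mcode q)))
  | Ch a i => to_nat (4, to_nat (a, i))
  end.

Lemma mcode_inj s t : mcode s = mcode t -> s = t.
Proof.
  destruct s, t; cbn [mcode]; intros H; apply to_nat_inj in H; try discriminate;
    injection H as H; subst; auto.
  apply to_nat_inj in H. injection H as -> H. apply to_nat_inj in H.
  now injection H as -> ->.
Qed.

Lemma ncode_inj s t : ncode s = ncode t -> s = t.
Proof.
  destruct s, t; cbn [ncode]; intros H; apply to_nat_inj in H; try discriminate; auto;
    injection H as H.
  - now apply mcode_inj in H as ->.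
  - now apply mcode_inj in H as ->.
  - apply to_nat_inj in H. injection H as -> H. apply to_nat_inj in H.
    injection H as -> H. now apply mcode_inj in H as ->.
  - apply to_nat_inj in H. now injection H as -> ->.
Qed.

Definition check : action := 1.
Definition next : action := 2.
Definition count : action := 3.
Definition drain : action := 4.
Definition label (s : mst) : action := 5 + mcode s.

Section Net.
Variable D : cm.

(** A triple [(a, b, q)] takes [n] to state [q] with counter [m] when [value s n = a * m + b]. An
    increment keeps the counter and leaves the multiplication to the slope of the next state. A
    decrement divides by the prime; a nonzero remainder [j] means that the register is 0, and
    [Mul k (base r) j] then rebuilds the old value from the quotient. *)
Definition trans (s : mst) : list (nat * nat * mst) :=
  match s with
  | Pg p =>
      match nth_error D p with
      | Some (INC r) => [(1, 0, Mul (S p) (base r) 0)]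
      | Some (DEC r k) =>
          (base r, 0, Pg (S p)) ::
          map (fun j => (base r, j, Mul k (base r) j)) (seq 1 (base r - 1))
      | None => []
      end
  | Mul k _ _ => [(1, 0, Pg k)]
  end.

(** One bound on targets, slopes and offsets that [trans] respects, so that finitely many states
    suffice. *)
Definition bound : nat :=
  fold_right (fun i n => n + match i with INC r => base r | DEC r k => base r + k end)
    (S (length D)) D.

Definition ok (s : mst) : Prop :=
  target s <= bound /\ 1 <= slope s <= bound /\ offset s <= bound.

Definition mstates : list mst :=
  map Pg (seq 0 (S bound)) ++
  flat_map (fun k => flat_map (fun a => map (Mul k a) (seq 0 (S bound))) (seq 1 bound))
    (seq 0 (S bound)).

Lemma bound_instr p i :
  nth_error D p = Some i ->
  S p <= bound /\ match i with INC r => base r <= bound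
                  | DEC r k => base r <= bound /\ k <= bound end.
Proof.
  intros H. split.
  - assert (p < length D) by (apply nth_error_Some; congruence).
    cut (S (length D) <= bound); [lia|]. unfold bound. generalize (S (length D)). clear.
    intros n. induction D as [|x l IH]; simpl; lia.
  - unfold bound. generalize (S (length D)). intros n.
    apply nth_error_In in H. induction D as [|x l IH]; [destruct H|]. destruct H as [->|H]; simpl.
    + destruct i; lia.
    + specialize (IH H). destruct i; lia.
Qed.

Lemma one_le_bound : 1 <= bound.
Proof.
  unfold bound. generalize (length D). intros n.
  induction D as [|x l IH]; simpl; lia.
Qed.

Lemma in_mstates s : In s mstates <-> ok s.
Proof.
  pose proof one_le_bound. unfold mstates, ok. rewrite in_app_iff, in_map_iff, in_flat_map.
  split.
  - intros [(p & <- & Hp)|(k & Hk & Hs)]; [apply in_seq in Hp; simpl; lia|].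
    apply in_flat_map in Hs as (a & Ha & Hs). apply in_map_iff in Hs as (j & <- & Hj).
    apply in_seq in Hk, Ha, Hj. simpl; lia.
  - destruct s as [p|k a j]; cbn [target slope offset]; intros Hs.
    + left. exists p. split; [reflexivity|]. apply (in_seq (S bound) 0). lia.
    + right. exists k. split; [apply (in_seq (S bound) 0); lia|].
      apply in_flat_map. exists a. split; [apply in_seq; lia|].
      apply in_map. apply (in_seq (S bound) 0). lia.
Qed.

Lemma trans_ok s a b q :
  ok s -> In (a, b, q) (trans s) -> ok q /\ 1 <= a <= bound /\ b <= bound.
Proof.
  pose proof one_le_bound. unfold ok. destruct s as [p|k a' j]; simpl; intros Hs Hin.
  - destruct (nth_error D p) as [[r|r k]|] eqn:Hp; [| |destruct Hin];
      apply bound_instr in Hp; pose proof (base_ge2 r).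
    + destruct Hin as [[= <- <- <-]|[]]. simpl. lia.
    + destruct Hin as [[= <- <- <-]|Hin]; [simpl; lia|].
      apply in_map_iff in Hin as (j & [= <- <- <-] & Hj). apply in_seq in Hj. simpl. lia.
  - destruct Hin as [[= <- <- <-]|[]]. simpl. lia.
Qed.

Definition edge := (nst * bool * action * nst * nat)%type.

(** The silent move to [Guess] lets [At s] imitate all of [Guess], so that the only real attack on
    the pair is [label s]. As this label names [s], the answer has to be a transition of [s]. *)
Definition state_edges (s : mst) : list edge :=
  [(At s, false, tau, Guess, 0); (At s, false, label s, Ask s, 0);
   (Ask s, false, check, Ch (slope s) (offset s), 0); (Ask s, false, next, Guess, 0)] ++
  flat_map (fun t => match t with (a, b, q) =>
      [(Guess, false, label s, Ans a b q, 0); (Ans a b q, false, check, Ch a b, 0);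
       (Ans a b q, false, next, At q, 0)] end) (trans s).

(** Consuming a token is itself a [count], and [a - 1] more follow, so each token is worth exactly
    [a]. *)
Definition chain_edges (a : nat) : list edge :=
  (Ch a 0, true, count, Ch a (a - 1), 0) ::
  map (fun i => (Ch a (S i), false, count, Ch a i, 0)) (seq 0 bound).

Definition edges : list edge :=
  [(Guess, false, tau, Guess, 1); (Guess, true, tau, Guess, 0);
   (Drain, true, tau, Drain, 0)] ++
  flat_map state_edges mstates ++ flat_map chain_edges (seq 1 bound).

Definition edge_rule (e : edge) : rule :=
  match e with (s, i, l, t, j) => Rule (ncode s) i l (ncode t) j end.

Definition net_size : nat :=
  S (list_max (flat_map (fun r => [r_src r; r_tgt r]) (map edge_rule edges))).

(** State numbers below [net_size] that code no [nst] are states of the net as well, and normedness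
    has to hold for them too. *)
Definition drain_rules : list rule :=
  map (fun p => Rule p false drain (ncode Drain) 0)
    (filter (fun p => negb (p =? ncode Drain)) (seq 0 net_size)).

Definition net : ocn := OCN net_size (map edge_rule edges ++ drain_rules).

Inductive nstep : nst -> nat -> action -> nst -> nat -> Prop :=
| n_up n : nstep Guess n tau Guess (S n)
| n_down n : nstep Guess (S n) tau Guess n
| n_drained n : nstep Drain (S n) tau Drain n
| n_at_guess s n : ok s -> nstep (At s) n tau Guess n
| n_at_ask s n : ok s -> nstep (At s) n (label s) (Ask s) n
| n_ask_check s n : ok s -> nstep (Ask s) n check (Ch (slope s) (offset s)) n
| n_ask_next s n : ok s -> nstep (Ask s) n next Guess n
| n_guess_ans s a b q n :
    ok s -> In (a, b, q) (trans s) -> nstep Guess n (label s) (Ans a b q) n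
| n_ans_check s a b q n :
    ok s -> In (a, b, q) (trans s) -> nstep (Ans a b q) n check (Ch a b) n
| n_ans_next s a b q n :
    ok s -> In (a, b, q) (trans s) -> nstep (Ans a b q) n next (At q) n
| n_chain_token a n : 1 <= a <= bound -> nstep (Ch a 0) (S n) count (Ch a (a - 1)) n
| n_chain a i n : 1 <= a <= bound -> S i <= bound -> nstep (Ch a (S i)) n count (Ch a i) n
| n_drain s n : s <> Drain -> ncode s < net_size -> nstep s n drain Drain n.

Lemma edge_nstep s i l t j k :
  In (s, i, l, t, j) edges -> nstep s ((if i : bool then 1 else 0) + k) l t (j + k).
Proof.
  intros H. unfold edges in H. apply in_app_or in H as [H|H].
  { simpl in H. destruct H as [H|[H|[H|[]]]]; injection H as <- <- <- <- <-; constructor. }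
  apply in_app_or in H as [H|H]; apply in_flat_map in H as (x & Hx & H).
  - apply in_mstates in Hx. apply in_app_or in H as [H|H].
    + simpl in H. destruct H as [H|[H|[H|[H|[]]]]]; injection H as <- <- <- <- <-;
        simpl; now constructor.
    + apply in_flat_map in H as ([[a b] q] & Hq & H). simpl in H.
      destruct H as [H|[H|[H|[]]]]; injection H as <- <- <- <- <-;
        simpl; econstructor; eauto.
  - apply in_seq in Hx. destruct H as [H|H].
    + injection H as <- <- <- <- <-. constructor. lia.
    + apply in_map_iff in H as (y & H & Hy). injection H as <- <- <- <- <-.
      apply in_seq in Hy. constructor; lia.
Qed.

Lemma edge_below e : In e edges ->
  match e with (s, _, _, t, _) => ncode s < net_size /\ ncode t < net_size end.
Proof.
  intros H. set (L := flat_map (fun r => [r_src r; r_tgt r]) (map edge_rule edges)).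
  assert (HL : Forall (fun x => x <= list_max L) L) by (apply list_max_le; lia).
  rewrite Forall_forall in HL. unfold net_size. fold L.
  destruct e as [[[[s i] l] t] j].
  assert (HI : forall x, In x [ncode s; ncode t] -> In x L).
  { intros x Hx. apply in_flat_map. exists (edge_rule (s, i, l, t, j)).
    split; [now apply in_map|exact Hx]. }
  split; apply Nat.lt_succ_r, HL, HI; simpl; auto.
Qed.

Lemma in_state_edges s e : ok s -> In e (state_edges s) -> In e edges.
Proof.
  intros Hs He. unfold edges. apply in_or_app; right; apply in_or_app; left.
  apply in_flat_map. exists s. now split; [apply in_mstates|].
Qed.

Lemma in_trans_edges s a b q e :
  ok s -> In (a, b, q) (trans s) ->
  In e [(Guess, false, label s, Ans a b q, 0); (Ans a b q, false, check, Ch a b, 0);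
        (Ans a b q, false, next, At q, 0)] -> In e edges.
Proof.
  intros Hs Ht He. apply (in_state_edges s); [assumption|].
  apply in_or_app; right. apply in_flat_map. now exists (a, b, q).
Qed.

Lemma in_chain_edges a e : 1 <= a <= bound -> In e (chain_edges a) -> In e edges.
Proof.
  intros Ha He. unfold edges. do 2 (apply in_or_app; right).
  apply in_flat_map. exists a. split; [apply in_seq; lia|assumption].
Qed.

Lemma nstep_edge s n l t m : nstep s n l t m ->
  (exists i j k, In (s, i, l, t, j) edges /\ n = (if i : bool then 1 else 0) + k /\ m = j + k)
  \/ (s <> Drain /\ ncode s < net_size /\ l = drain /\ t = Drain /\ m = n).
Proof.
  intros H. destruct H as [n|n|n|s n Hs|s n Hs|s n Hs|s n Hs|s a b q n Hs Ht|s a b q n Hs Ht|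
    s a b q n Hs Ht|a n Ha|a i n Ha Hi|s n Hd Hl]; [left..|right; auto].
  - exists false, 1, n. split; [now left|auto].
  - exists true, 0, n. split; [now right; left|auto].
  - exists true, 0, n. split; [now right; right; left|auto].
  - exists false, 0, n. split; [|auto]. apply (in_state_edges s); simpl; auto.
  - exists false, 0, n. split; [|auto]. apply (in_state_edges s); simpl; auto.
  - exists false, 0, n. split; [|auto]. apply (in_state_edges s); simpl; auto.
  - exists false, 0, n. split; [|auto]. apply (in_state_edges s); simpl; auto.
  - exists false, 0, n. split; [|auto]. apply (in_trans_edges s a b q); simpl; auto.
  - exists false, 0, n. split; [|auto]. apply (in_trans_edges s a b q); simpl; auto.
  - exists false, 0, n. split; [|auto]. apply (in_trans_edges s a b q); simpl; auto.
  - exists true, 0, n. split; [|auto]. apply (in_chain_edges a); simpl; auto.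
  - exists false, 0, n. split; [|auto]. apply (in_chain_edges a); [assumption|].
    right. apply in_map_iff. exists i. split; [reflexivity|]. apply in_seq; lia.
Qed.

Local Opaque edges net_size.

Lemma nstep_below s n l t m : nstep s n l t m -> ncode s < net_size.
Proof.
  intros H. apply nstep_edge in H as [(i & j & k & H & _)|H]; [|tauto].
  now apply edge_below in H.
Qed.

Lemma step_net s n l P :
  step net (ncode s, n) l P <-> exists t m, P = (ncode t, m) /\ nstep s n l t m.
Proof.
  split.
  - intros (r & k & Hr & HP & -> & ->). injection HP as Hs Hn.
    simpl in Hr. apply in_app_or in Hr as [Hr|Hr]; apply in_map_iff in Hr.
    + destruct Hr as ([[[[s' i] l] t] j] & <- & Hin). simpl in *.
      apply ncode_inj in Hs as <-. exists t, (j + k). split; [reflexivity|].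
      rewrite Hn. now apply edge_nstep.
    + destruct Hr as (p & <- & Hin). apply filter_In in Hin as [Hin Hp].
      apply in_seq in Hin. simpl in *. subst p.
      exists Drain, k. split; [reflexivity|]. rewrite Hn.
      constructor; [|lia]. intros ->. now rewrite Nat.eqb_refl in Hp.
  - intros (t & m & -> & H).
    apply nstep_edge in H as [(i & j & k & H & -> & ->)|(Hs & Hl & -> & -> & ->)].
    + exists (edge_rule (s, i, l, t, j)), k. repeat split.
      apply in_or_app; left. now apply in_map.
    + exists (Rule (ncode s) false drain (ncode Drain) 0), n. repeat split.
      apply in_or_app; right. apply in_map_iff. exists (ncode s). split; [reflexivity|].
      apply filter_In. split; [apply in_seq; lia|].
      destruct (Nat.eqb_spec (ncode s) (ncode Drain)); [|reflexivity].
      now apply ncode_inj in e.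
Qed.

Lemma step_net_intro s n l t m : nstep s n l t m -> step net (ncode s, n) l (ncode t, m).
Proof. intros H. apply step_net. eauto. Qed.

Lemma drain_below : ncode Drain < net_size.
Proof. apply (nstep_below Drain 1 tau Drain 0). constructor. Qed.

Lemma net_wf : ocn_wf net.
Proof.
  intros r Hr. simpl in *. apply in_app_or in Hr as [Hr|Hr]; apply in_map_iff in Hr.
  - destruct Hr as (e & <- & He). apply edge_below in He.
    now destruct e as [[[[s i] l] t] j].
  - destruct Hr as (p & <- & Hp). apply filter_In in Hp as [Hp _]. apply in_seq in Hp.
    simpl. pose proof drain_below. simpl in *. lia.
Qed.

Lemma net_normed : normed net.
Proof.
  assert (Hd : forall n, reach net (ncode Drain, n) (ncode Drain, 0)).
  { induction n as [|n IH]; [apply reach_refl|].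
    eapply reach_step; [|exact IH]. apply (step_net_intro Drain _ tau Drain). constructor. }
  intros [p n] Hp. exists (ncode Drain). split.
  - destruct (Nat.eq_dec p (ncode Drain)) as [->|Hne]; [apply Hd|].
    eapply reach_step with (l := drain) (P' := (ncode Drain, n)); [|apply Hd].
    exists (Rule p false drain (ncode Drain) 0), n. repeat split.
    apply in_or_app; right. apply in_map_iff. exists p. split; [reflexivity|].
    apply filter_In. split; [apply in_seq; unfold is_proc in Hp; simpl in *; lia|].
    now destruct (Nat.eqb_spec p (ncode Drain)).
  - intros l P' H. apply step_net in H as (t & m & _ & H). inversion H; congruence.
Qed.

Lemma tau_star_trans N P1 P2 P3 : tau_star N P1 P2 -> tau_star N P2 P3 -> tau_star N P1 P3.
Proof. induction 1; eauto using tau_star. Qed.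

Lemma guess_any n m : tau_star net (ncode Guess, n) (ncode Guess, m).
Proof.
  apply tau_star_trans with (ncode Guess, 0).
  - induction n as [|n IH]; [apply ts_refl|].
    eapply ts_step; [|exact IH]. apply (step_net_intro Guess _ tau Guess). constructor.
  - assert (H : forall k, tau_star net (ncode Guess, k) (ncode Guess, k + m)).
    { induction m as [|m' IH]; intros k; [rewrite Nat.add_0_r; apply ts_refl|].
      rewrite Nat.add_succ_r, <- Nat.add_succ_l. eapply ts_step; [|apply IH].
      apply (step_net_intro Guess _ tau Guess). constructor. }
    apply (H 0).
Qed.

(** * Machine runs as sequences of affine steps *)

Definition diverging (s : mst) (n : nat) : Prop :=
  0 < value s n /\ forall f, cm_exec D f (target s) (regs_of (value s n)) = None.

(** This supplies the defender's claim [m]. Positivity is carried along because multiplying 0 by a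
    prime would not increment a register. *)
Lemma diverging_next s n :
  diverging s n ->
  exists a b q m, In (a, b, q) (trans s) /\ value s n = a * m + b /\ diverging q m.
Proof.
  unfold diverging. intros [Hpos Hdiv]. destruct s as [p|k a j].
  2: { exists 1, 0, (Pg k), (value (Mul k a j) n). split; [now left|].
       rewrite value_Pg, Nat.mul_1_l, Nat.add_0_r. auto. }
  rewrite value_Pg in *. cbn [target] in *.
  destruct (nth_error D p) as [i|] eqn:Hp.
  2: { apply nth_error_None in Hp. specialize (Hdiv 0). simpl in Hdiv.
       rewrite (proj2 (Nat.leb_le _ _) Hp) in Hdiv. discriminate. }
  assert (Hlt : (length D <=? p) = false).
  { apply Nat.leb_gt, nth_error_Some. congruence. }
  assert (Hnext : forall f, (let (p', g') := cm_step D p (regs_of n) in cm_exec D f p' g') = None).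
  { intros f. specialize (Hdiv (S f)). cbn [cm_exec] in Hdiv. now rewrite Hlt in Hdiv. }
  unfold cm_step in Hnext. rewrite Hp in Hnext. cbn [trans]. rewrite Hp.
  destruct i as [r|r k]; pose proof (base_ge2 r) as Hb.
  - exists 1, 0, (Mul (S p) (base r) 0), n. split; [now left|].
    unfold value; cbn [slope offset target]. rewrite !Nat.add_0_r.
    rewrite regs_of_mul by assumption. split; [lia|]. split; [nia|exact Hnext].
  - destruct (regs_of n r) as [|v] eqn:Hr.
    + pose proof (Nat.div_mod_eq n (base r)) as Hn.
      pose proof (Nat.mod_upper_bound n (base r)) as Hj.
      exists (base r), (n mod base r), (Mul k (base r) (n mod base r)), (n / base r).
      unfold value; cbn [slope offset target]. rewrite <- Hn.
      split; [|auto]. right. apply in_map_iff. eexists; split; [reflexivity|].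
      (* Remainder 0 would make the exponent of [base r] positive, but the register is 0. *)
      apply in_seq. destruct (Nat.eq_dec (n mod base r) 0) as [E|]; [|lia].
      rewrite E, Nat.add_0_r in Hn. rewrite Hn, regs_of_mul in Hr.
      * unfold upd in Hr. now rewrite Nat.eqb_refl in Hr.
      * destruct (n / base r); lia.
    + destruct (expo_gt0 r n) as [m Hm]; [unfold regs_of in Hr; lia|].
      assert (0 < m) by (destruct m; lia). subst n.
      exists (base r), 0, (Pg (S p)), m. split; [now left|].
      unfold value; cbn [slope offset target]. rewrite !Nat.add_0_r, Nat.mul_1_l.
      rewrite regs_of_div in Hnext by assumption. auto.
Qed.

(** Accessibility along correct claims: its induction principle is the attacker's winning
    strategy. *)
Inductive terminating : mst -> nat -> Prop :=
| terminating_intro s n :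
    (forall a b q m, In (a, b, q) (trans s) -> value s n = a * m + b -> terminating q m) ->
    terminating s n.

Lemma halting_terminating f p n h :
  0 < n -> cm_exec D f p (regs_of n) = Some h -> terminating (Pg p) n.
Proof.
  revert p n. induction f as [|f IH]; intros p n Hn H; cbn [cm_exec] in H;
    destruct (Nat.leb_spec (length D) p) as [Hle|Hlt]; try discriminate;
    constructor; intros a b q m Hin; unfold value at 1; cbn [slope offset trans] in *;
    try (rewrite (proj2 (nth_error_None _ _) Hle) in Hin; destruct Hin);
    rewrite Nat.add_0_r, Nat.mul_1_l; intros Hm.
  unfold cm_step in H. destruct (nth_error D p) as [[r|r k]|]; [| |destruct Hin];
    pose proof (base_ge2 r) as Hb.
  - destruct Hin as [[= <- <- <-]|[]]. rewrite Nat.add_0_r, Nat.mul_1_l in Hm. subst m.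
    (* The [Mul] state only reads off its value, so unfolding once more reaches the configuration
       after the machine step. *)
    constructor. intros a b q m [[= <- <- <-]|[]]. unfold value; cbn [slope offset].
    rewrite !Nat.add_0_r, Nat.mul_1_l. intros <-. apply IH; [nia|].
    now rewrite regs_of_mul.
  - destruct Hin as [[= <- <- <-]|Hin].
    + rewrite Nat.add_0_r in Hm. subst n. assert (0 < m) by (destruct m; lia).
      apply IH; [assumption|].
      destruct (regs_of (base r * m) r) as [|v] eqn:Hr.
      * rewrite regs_of_mul in Hr by assumption. unfold upd in Hr.
        now rewrite Nat.eqb_refl in Hr.
      * now rewrite regs_of_div in H.
    + apply in_map_iff in Hin as (j & [= <- <- <-] & Hj). apply in_seq in Hj.
      constructor. intros a b q m' [[= <- <- <-]|[]]. unfold value; cbn [slope offset].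
      rewrite Nat.add_0_r, Nat.mul_1_l. intros <-. rewrite <- Hm. apply IH; [assumption|].
      destruct (regs_of n r) as [|v] eqn:Hr; [exact H|].
      (* A nonzero register would make [base r] divide [n], against the remainder [j] with
         [1 <= j < base r]. *)
      destruct (expo_gt0 r n) as [d Hd]; [unfold regs_of in Hr; lia|]. exfalso.
      assert (E : n mod base r = 0) by (rewrite Hd, Nat.mul_comm; apply Nat.Div0.mod_mul).
      rewrite Hm, Nat.add_comm, Nat.mul_comm, Nat.Div0.mod_add, Nat.mod_small in E; lia.
Qed.

(** * Counting chains and the branching bisimulation *)

Definition chain_ok (a i : nat) : Prop := 1 <= a <= bound /\ i <= bound.

Lemma chain_count a i n v :
  chain_ok a i -> a * n + i = S v ->
  exists i' n', nstep (Ch a i) n count (Ch a i') n' /\ chain_ok a i' /\ a * n' + i' = v.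
Proof.
  intros [Ha Hi] Hv. destruct i as [|i].
  - destruct n as [|n]; [lia|]. exists (a - 1), n.
    split; [now constructor|]. unfold chain_ok. split; [lia|]. nia.
  - exists i, n. split; [constructor; lia|]. unfold chain_ok. lia.
Qed.

Lemma chain_nstep a i n l s n' :
  nstep (Ch a i) n l s n' ->
  (l = count /\ exists i', s = Ch a i' /\ chain_ok a i' /\ S (a * n' + i') = a * n + i)
  \/ (l = drain /\ s = Drain).
Proof.
  intros H. inversion H; subst; [left|left|right]; split; auto.
  - exists (a - 1). unfold chain_ok. split; [reflexivity|]. lia.
  - exists i0. unfold chain_ok. split; [reflexivity|]. lia.
Qed.

Lemma chain_below a i : chain_ok a i -> ncode (Ch a i) < net_size.
Proof.
  intros Hc. destruct (chain_count a i 1 (a + i - 1) Hc) as (i' & n' & H & _).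
  - destruct Hc. lia.
  - exact (nstep_below _ _ _ _ _ H).
Qed.

(** For an asking and an answering state, the value equation meets the attack by [check] and
    divergence of the successor meets [next]. The relation is symmetric, so one direction of the
    game suffices. *)
Inductive bisim : nst -> nat -> nst -> nat -> Prop :=
| b_refl s n : bisim s n s n
| b_guess n m : bisim Guess n Guess m
| b_drain n m : bisim Drain n Drain m
| b_at_guess s n m : ok s -> diverging s n -> bisim (At s) n Guess m
| b_guess_at s n m : ok s -> diverging s n -> bisim Guess m (At s) n
| b_ask_ans s a b q n m :
    ok s -> In (a, b, q) (trans s) -> value s n = a * m + b -> diverging q m ->
    bisim (Ask s) n (Ans a b q) m
| b_ans_ask s a b q n m :
    ok s -> In (a, b, q) (trans s) -> value s n = a * m + b -> diverging q m ->
    bisim (Ans a b q) m (Ask s) n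
| b_chain a i n a' i' n' :
    chain_ok a i -> chain_ok a' i' -> a * n + i = a' * n' + i' ->
    bisim (Ch a i) n (Ch a' i') n'.

Lemma bisim_sym s n t m : bisim s n t m -> bisim t m s n.
Proof. destruct 1; constructor; auto. Qed.

Definition lift (P Q : proc) : Prop :=
  exists s n t m, P = (ncode s, n) /\ Q = (ncode t, m) /\ bisim s n t m.

Definition matched (s : nst) (n : nat) (t : nst) (m : nat) (l : action) (s' : nst) (n' : nat) :=
  (exists t1 m1 t' m', tau_star net (ncode t, m) (ncode t1, m1) /\ nstep t1 m1 l t' m' /\
     bisim s n t1 m1 /\ bisim s' n' t' m')
  \/ (l = tau /\ bisim s' n' t m).

Lemma matched_now s n t m l s' n' t' m' :
  bisim s n t m -> nstep t m l t' m' -> bisim s' n' t' m' -> matched s n t m l s' n'.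
Proof. intros. left. exists t, m, t', m'. repeat split; auto. apply ts_refl. Qed.

Lemma at_reaches_guess s n m : ok s -> tau_star net (ncode (At s), n) (ncode Guess, m).
Proof.
  intros Hs. eapply ts_step; [|apply (guess_any n)].
  apply (step_net_intro (At s) _ tau Guess). now constructor.
Qed.

Lemma bisim_matched s n t m l s' n' :
  bisim s n t m -> nstep s n l s' n' -> matched s n t m l s' n'.
Proof.
  intros HB H. pose proof HB as HB0.
  destruct HB as [s n|n m|n m|s n m Hs Hd|s n m Hs Hd|s a b q n m Hs Ht Hv Hd|
    s a b q n m Hs Ht Hv Hd|a i n a' i' n2 Hc Hc' He].
  - apply (matched_now _ _ _ _ _ _ _ s' n' HB0 H). constructor.
  - inversion H; subst.
    + right. split; [reflexivity|constructor].
    + right. split; [reflexivity|constructor].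
    + left. exists Guess, n', (Ans a b q), n'. split; [apply guess_any|].
      split; [now apply (n_guess_ans s)|]. split; constructor.
    + apply (matched_now _ _ _ _ _ _ _ Drain m HB0); [now constructor|constructor].
  - inversion H; subst; [right; split; [reflexivity|constructor]|congruence].
  - inversion H; subst.
    + right. split; [reflexivity|constructor].
    (* [Guess] silently sets its counter to the true successor value [k]; all [Guess] processes
       being related, the intermediate condition of branching bisimulation holds. *)
    + destruct (diverging_next s n' Hd) as (a & b & q & k & Ht & Hv & Hq).
      left. exists Guess, k, (Ans a b q), k. split; [apply guess_any|].
      split; [now apply (n_guess_ans s)|]. split; [now constructor|].
      now apply (b_ask_ans s).
    + apply (matched_now _ _ _ _ _ _ _ Drain m HB0); [|constructor].
      constructor; [discriminate|]. apply (nstep_below Guess 0 tau Guess 1). constructor.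
  - inversion H; subst.
    + right. split; [reflexivity|now constructor].
    + right. split; [reflexivity|now constructor].
    (* Attacked from the [Guess] side, [At s] becomes [Guess] with the attacker's counter and copies
       the move, ending in an identical process. *)
    + left. exists Guess, n', (Ans a b q), n'. split; [now apply at_reaches_guess|].
      split; [now apply (n_guess_ans s0)|]. split; constructor.
    + apply (matched_now _ _ _ _ _ _ _ Drain n HB0); [|constructor].
      constructor; [discriminate|]. apply (nstep_below (At s) 0 tau Guess 0). now constructor.
  - destruct (trans_ok s a b q Hs Ht) as (Hq & Ha & Hb). inversion H; subst.
    + apply (matched_now _ _ _ _ _ _ _ (Ch a b) m HB0); [now apply (n_ans_check s a b q)|].
      destruct Hs as (_ & Hs1 & Hs2). now constructor.
    (* The pair is now [Guess] against the diverging [At q], with the sides swapped. *)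
    + apply (matched_now _ _ _ _ _ _ _ (At q) m HB0); [now apply (n_ans_next s a b q)|].
      now constructor.
    + apply (matched_now _ _ _ _ _ _ _ Drain m HB0); [|constructor].
      constructor; [discriminate|]. apply (nstep_below _ 0 check (Ch a b) 0).
      now apply (n_ans_check s a b q).
  - destruct (trans_ok s a b q Hs Ht) as (Hq & Ha & Hb). inversion H; subst.
    + apply (matched_now _ _ _ _ _ _ _ (Ch (slope s) (offset s)) n HB0); [now constructor|].
      destruct Hs as (_ & Hs1 & Hs2). now constructor.
    + apply (matched_now _ _ _ _ _ _ _ Guess n HB0); [now constructor|].
      now constructor.
    + apply (matched_now _ _ _ _ _ _ _ Drain n HB0); [|constructor].
      constructor; [discriminate|]. apply (nstep_below (Ask s) 0 next Guess 0).
      now constructor.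
  - destruct (chain_nstep _ _ _ _ _ _ H) as [(-> & j & -> & Hj & Hv)|(-> & ->)].
    + destruct (chain_count a' i' n2 (a * n' + j) Hc') as (j' & m' & H' & Hj' & Hv'); [lia|].
      apply (matched_now _ _ _ _ _ _ _ _ _ HB0 H'). constructor; auto; lia.
    + apply (matched_now _ _ _ _ _ _ _ Drain n2 HB0); [|constructor].
      constructor; [discriminate|now apply chain_below].
Qed.

Lemma lift_branching : is_branching_bisim net lift.
Proof.
  assert (Half : forall P Q l P', lift P Q -> step net P l P' ->
    (exists Q'' Q', tau_star net Q Q'' /\ step net Q'' l Q' /\ lift P Q'' /\ lift P' Q')
    \/ (l = tau /\ lift P' Q)).
  { intros P Q l P' (s & n & t & m & -> & -> & HB) H.
    apply step_net in H as (s' & n' & -> & H).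
    destruct (bisim_matched _ _ _ _ _ _ _ HB H)
      as [(t1 & m1 & t' & m' & H1 & H2 & H3 & H4)|[-> H1]].
    - left. exists (ncode t1, m1), (ncode t', m'). split; [exact H1|].
      split; [now apply step_net_intro|]. split; repeat eexists; eassumption.
    - right. split; [reflexivity|]. repeat eexists; eassumption. }
  assert (Sym : forall P Q, lift P Q -> lift Q P).
  { intros P Q (s & n & t & m & -> & -> & HB). apply bisim_sym in HB.
    repeat eexists; eassumption. }
  intros P Q HB. split; [intros l P' H; now apply (Half P Q)|].
  intros l Q' H. destruct (Half Q P l Q' (Sym _ _ HB) H)
    as [(P'' & P' & H1 & H2 & H3 & H4)|[-> H1]].
  - left. exists P'', P'. auto.
  - right. auto.
Qed.

Lemma diverging_bisimilar s n m :
  ok s -> diverging s n -> branching_bisimilar net (ncode (At s), n) (ncode Guess, m).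
Proof.
  intros Hs Hd. exists lift. split; [exact lift_branching|].
  exists (At s), n, Guess, m. repeat split. now constructor.
Qed.

(** * Terminating configurations are not weakly bisimilar to [Guess] *)

Lemma tau_star_stuck s n P :
  (forall t m, ~ nstep s n tau t m) -> tau_star net (ncode s, n) P -> P = (ncode s, n).
Proof.
  intros Hs H. inversion H as [|? P' ? H1 H2]; subst; [reflexivity|].
  apply step_net in H1 as (t & m & _ & H1). now apply Hs in H1.
Qed.

Lemma tau_star_guess n P :
  tau_star net (ncode Guess, n) P -> exists m, P = (ncode Guess, m).
Proof.
  intros H. remember (ncode Guess, n) as P0 eqn:E. revert n E.
  induction H as [P0|P0 P1 P2 H1 _ IH]; intros n ->; [eauto|].
  apply step_net in H1 as (t & m & -> & H1). inversion H1; subst; eauto.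
Qed.

Lemma weak_step_visible N P l P' :
  l <> tau -> weak_step N P l P' ->
  exists P1 P2, tau_star N P P1 /\ step N P1 l P2 /\ tau_star N P2 P'.
Proof. intros Hl. unfold weak_step. now rewrite (proj2 (Nat.eqb_neq _ _) Hl). Qed.

Lemma is_weak_bisim_sym N B : is_weak_bisim N B -> is_weak_bisim N (fun P Q => B Q P).
Proof.
  intros H P Q HB. destruct (H Q P HB) as [H1 H2]. split; assumption.
Qed.

(** Chains have no silent moves, so weak answers are strong ones, and each [count] lowers both
    values by 1. *)
Lemma weak_chain B a i n a' i' n' :
  is_weak_bisim net B -> chain_ok a i -> chain_ok a' i' ->
  B (ncode (Ch a i), n) (ncode (Ch a' i'), n') -> a * n + i = a' * n' + i'.
Proof.
  assert (Hstep : forall B a i n a' i' n' v, is_weak_bisim net B -> chain_ok a i ->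
    chain_ok a' i' -> B (ncode (Ch a i), n) (ncode (Ch a' i'), n') -> a * n + i = S v ->
    exists j m j' m', chain_ok a j /\ chain_ok a' j' /\
      B (ncode (Ch a j), m) (ncode (Ch a' j'), m') /\
      a * m + j = v /\ S (a' * m' + j') = a' * n' + i').
  { clear. intros B a i n a' i' n' v HW Hc Hc' HB Hv.
    destruct (chain_count a i n v Hc Hv) as (j & m & H & Hj & Hm).
    destruct (proj1 (HW _ _ HB) _ _ (step_net_intro _ _ _ _ _ H)) as (Q & HQ & HB').
    apply weak_step_visible in HQ as (P1 & P2 & H1 & H2 & H3); [|discriminate].
    apply tau_star_stuck in H1; [subst P1|intros ? ? HH; now inversion HH].
    apply step_net in H2 as (t & m' & -> & H2).
    apply chain_nstep in H2 as [(_ & j' & -> & Hj' & Hm')|(? & _)]; [|discriminate].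
    apply tau_star_stuck in H3; [subst Q|intros ? ? HH; now inversion HH].
    exists j, m, j', m'. auto. }
  intros HW. remember (a * n + i) as v eqn:Hv. symmetry in Hv.
  remember (a' * n' + i') as v' eqn:Hv'. symmetry in Hv'.
  revert a i n a' i' n' v' Hv Hv'.
  induction v as [|v IH]; intros a i n a' i' n' v' Hv Hv' Hc Hc' HB.
  - destruct v' as [|v']; [reflexivity|].
    (* With value 0 on the left, a [count] played on the right has no answer. *)
    destruct (Hstep _ a' i' n' a i n v' (is_weak_bisim_sym _ _ HW) Hc' Hc HB Hv')
      as (j & m & j' & m' & _ & _ & _ & _ & E). lia.
  - destruct (Hstep _ a i n a' i' n' v HW Hc Hc' HB Hv)
      as (j & m & j' & m' & Hj & Hj' & HB' & Hm & Hm').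
    rewrite (IH a j m a' j' m' (a' * m' + j') Hm eq_refl Hj Hj' HB'). lia.
Qed.

Lemma guess_label s n t m :
  nstep Guess n (label s) t m -> exists a b q, In (a, b, q) (trans s) /\ t = Ans a b q.
Proof.
  intros H. inversion H; subst.
  match goal with E : mcode _ = mcode _ |- _ => apply mcode_inj in E as -> end. eauto.
Qed.

(** The attacker asks, and [check] forces the claim to be correct, so [next] leads to an accessible
    successor. [B] is quantified after the induction variables because the sides swap in each
    round. *)
Lemma terminating_not_bisim s n :
  terminating s n -> ok s ->
  forall B k, is_weak_bisim net B -> ~ B (ncode (At s), n) (ncode Guess, k).
Proof.
  induction 1 as [s n _ IH]. intros Hs B k HW HB.
  destruct (proj1 (HW _ _ HB) _ _ (step_net_intro _ _ _ _ _ (n_at_ask s n Hs)))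
    as (Q & HQ & HB1).
  apply weak_step_visible in HQ as (P1 & P2 & H1 & H2 & H3); [|discriminate].
  apply tau_star_guess in H1 as [m0 ->].
  apply step_net in H2 as (t & m & -> & H2).
  apply guess_label in H2 as (a & b & q & Ht & ->).
  apply tau_star_stuck in H3; [subst Q|intros ? ? HH; now inversion HH].
  assert (Hval : value s n = a * m + b).
  { destruct (proj1 (HW _ _ HB1) _ _ (step_net_intro _ _ _ _ _ (n_ask_check s n Hs)))
      as (Q & HQ & HB2).
    apply weak_step_visible in HQ as (P1 & P2 & H1 & H4 & H5); [|discriminate].
    apply tau_star_stuck in H1; [subst P1|intros ? ? HH; now inversion HH].
    apply step_net in H4 as (t & m' & -> & H4). inversion H4; subst.
    apply tau_star_stuck in H5; [subst Q|intros ? ? HH; now inversion HH].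
    destruct (trans_ok s a b q Hs Ht) as (_ & Ha & Hb), Hs as (_ & Hs1 & Hs2).
    eapply weak_chain; [exact HW| | |exact HB2]; split; auto. }
  (* The attacker moves on the answering side; the asking side can only become some [Guess], and the
     induction hypothesis applies to the converse of [B]. *)
  destruct (proj2 (HW _ _ HB1) _ _ (step_net_intro _ _ _ _ _ (n_ans_next s a b q m Hs Ht)))
    as (Q & HQ & HB2).
  apply weak_step_visible in HQ as (P1 & P2 & H1 & H4 & H5); [|discriminate].
  apply tau_star_stuck in H1; [subst P1|intros ? ? HH; now inversion HH].
  apply step_net in H4 as (t & m' & -> & H4). inversion H4; subst.
  apply tau_star_guess in H5 as [k' ->].
  apply (IH a b q m Ht Hval (proj1 (trans_ok s a b q Hs Ht)) _ k' (is_weak_bisim_sym _ _ HW) HB2).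
Qed.

End Net.

(** * The diagonal argument *)

Theorem theorem1 :
  forall Rel : ocn -> proc -> proc -> Prop,
    (forall N P Q, branching_bisimilar N P Q -> Rel N P Q) ->
    (forall N P Q, Rel N P Q -> weakly_bisimilar N P Q) ->
    ~ exists M : cm, decides M Rel.
Proof.
  intros Rel Hbr Hwk [M HM].
  (* The codes of these two states do not depend on the machine, so [D] can contain them; the code
     of its own net, which does depend on [D], comes in as the input [c]. *)
  set (k := npair (ncode Guess) 0).
  set (D := diagonal M (ncode (At (Pg 0))) k).
  set (c := code_ocn (net D)).
  set (P := (ncode (At (Pg 0)), 2 ^ c)). set (Q := (ncode Guess, 0)).
  assert (Hcode : code_instance (net D) P Q =
                  npair c (npair (npair (ncode (At (Pg 0))) (2 ^ c)) k)) by reflexivity.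
  assert (Hpos : 0 < 2 ^ c) by (apply Nat.neq_0_lt_0, Nat.pow_nonzero; discriminate).
  assert (Hok : ok D (Pg 0)) by (pose proof (one_le_bound D); unfold ok; simpl; lia).
  destruct (HM (net D) P Q (net_wf D) (net_normed D)) as [Hyes Hno].
  { apply (nstep_below D _ 0 tau Guess 0). now constructor. }
  { apply (nstep_below D _ 0 tau Guess 1). constructor. }
  rewrite Hcode in Hyes, Hno.
  (* If related, [D] halts on [c], and the processes are not even weakly bisimilar. Refuting [Rel]
     first avoids excluded middle. *)
  assert (HnR : ~ Rel (net D) P Q).
  { intros HR. destruct (diagonal_halts _ _ _ _ (Hyes HR)) as (f & h & Hf).
    rewrite <- regs_of_pow2 in Hf. apply halting_terminating in Hf; [|exact Hpos].
    destruct (Hwk _ _ _ HR) as (B & HW & HB).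
    exact (terminating_not_bisim D _ _ Hf Hok B 0 HW HB). }
  (* The answer is then 0, so [D] runs forever and the processes are branching bisimilar after
     all. *)
  apply HnR, Hbr, diverging_bisimilar; [exact Hok|]. split; rewrite value_Pg; [exact Hpos|].
  rewrite regs_of_pow2. exact (diagonal_diverges _ _ _ _ (Hno HnR)).
Qed.
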